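(* Let $k$ be an indeterminate and define $$a(k)=10k^2-8k+8,\qquad b(k)=k(k^2-4k+20),\qquad c(k)=(k+2)(k^2-4).$$ Consider the elliptic curve over the rational function field $\mathbb{Q}(k)$ given by $$E:\ y^2=\big(x+a(k)b(k)\big)\big(x+b(k)c(k)\big)\big(x+a(k)c(k)\big).$$ The torsion subgroup of $E(\mathbb{Q}(k))$ is isomorphic to $\mathbb{Z}/2\mathbb{Z}\times\mathbb{Z}/2\mathbb{Z}$.
   Context: When specializing $k$ to a rational number, the values $k=0,\pm2$ are excluded. *)

(* Defs.v *)
From HB Require Import structures.
From mathcomp Require Import all_boot all_order all_algebra.
Set Implicit Arguments. Unset Strict Implicit. Unset Printing Implicit Defensive.
Import Order.TTheory GRing.Theory Num.Theory.
Local Open Scope ring_scope.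

Inductive point (F : Type) := Inf | Pt of F & F.
Arguments Inf {F}.

Section Curve.
Variable F : fieldType.
Variables a2 a4 a6 : F.

Definition on_curve (P : point F) : Prop :=
  match P with
  | Inf => True
  | Pt x y => y ^+ 2 = x ^+ 3 + a2 * x ^+ 2 + a4 * x + a6
  end.

Definition neg_pt (P : point F) : point F :=
  match P with Inf => Inf | Pt x y => Pt x (- y) end.

(* Chord-and-tangent group law (a1 = a3 = 0). *)
Definition add_pt (P Q : point F) : point F :=
  match P, Q with
  | Inf, _ => Q
  | _, Inf => P
  | Pt x1 y1, Pt x2 y2 =>
    if (x1 == x2) && (y1 == - y2) then Inf else
    let l := if x1 == x2
             then (3%:R * x1 ^+ 2 + 2%:R * a2 * x1 + a4) / (2%:R * y1)
             else (y2 - y1) / (x2 - x1) in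
    let x3 := l ^+ 2 - a2 - x1 - x2 in
    Pt x3 (- (l * (x3 - x1) + y1))
  end.

Fixpoint mul_pt (n : nat) (P : point F) : point F :=
  match n with O => Inf | S m => add_pt P (mul_pt m P) end.

Definition torsion_pt (P : point F) : Prop :=
  on_curve P /\ exists n : nat, (0 < n)%N /\ mul_pt n P = Inf.

Definition torsion_iso (G : zmodType) : Prop :=
  exists f : G -> point F,
    [/\ injective f,
        (forall u, on_curve (f u)),
        (forall u v, f (u + v) = add_pt (f u) (f v)) &
        (forall P, torsion_pt P <-> exists u, f u = P)].
End Curve.

Definition Qk := {fraction {poly rat}}.
Definition kk : Qk := tofrac ('X : {poly rat}).

Definition ak : Qk := 10%:R * kk ^+ 2 - 8%:R * kk + 8%:R.
Definition bk : Qk := kk * (kk ^+ 2 - 4%:R * kk + 20%:R).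
Definition ck : Qk := (kk + 2%:R) * (kk ^+ 2 - 4%:R).

(* (x + p)(x + q)(x + r) = x^3 + (p+q+r) x^2 + (pq+qr+rp) x + pqr *)
Definition e1 : Qk := ak * bk.
Definition e2 : Qk := bk * ck.
Definition e3 : Qk := ak * ck.
Definition A2 : Qk := e1 + e2 + e3.
Definition A4 : Qk := e1 * e2 + e2 * e3 + e3 * e1.
Definition A6 : Qk := e1 * e2 * e3.

(* Main.v *)
Require Import Defs.
From HB Require Import structures.
From mathcomp Require Import all_boot all_order all_algebra separable ring.
Set Implicit Arguments. Unset Strict Implicit. Unset Printing Implicit Defensive.
Import Order.TTheory GRing.Theory Num.Theory.
Local Open Scope ring_scope.

(* Let P be a torsion point with y(P) <> 0 and put R = 2P = (X, Y). The
   duplication formula gives X + e_i = u_i^2 in Q(k). At every place of Q[k] the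
   formal group is torsion free (residue characteristic 0), so torsion points
   have polynomial coordinates; applied to R and 2R this gives the theorem of
   Nagell and Lutz: if Y <> 0, then Y = +- u_1 u_2 u_3 divides the derivative of
   the cubic at X, which is the sum of the u_i^2 u_j^2, so u_1 divides
   (u_2 u_3)^2. The square of a common factor of u_1 and u_2 divides
   e_2 - e_1 = b(c - a), that of a common factor of u_1 and u_3 divides
   e_3 - e_1 = a(c - b), and both differences are squarefree. Thus u_1 is a
   constant, and u_3^2 = e_3 - e_1 + u_1^2 is a square with leading coefficient
   60, which is absurd. If Y = 0, then u_1^2 is 0, e_1 - e_2 or e_1 - e_3, with
   leading coefficients -1 and -60 in the last two cases. Only the identity
   P + (P + Q) = 2P + Q is needed from the associativity of the group law, to
   see that 2P is torsion. *)

Local Notation "x %:F" := (tofrac x).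

(** * Chords and tangents *)

Section ChordTangent.
Variable F : fieldType.
Variables a2 a4 a6 : F.
Implicit Types (l x y : F) (P Q : point F).

Local Notation on_curve := (on_curve a2 a4 a6).
Local Notation add_pt := (add_pt a2 a4).
Local Notation mul_pt := (mul_pt a2 a4).
Local Notation torsion_pt := (torsion_pt a2 a4 a6).

(* Both the chord and the tangent slope satisfy both equations: the second one
   is the first multiplied by [(y1 + y2) / (x2 - x1)], rewritten with the
   equation of the curve. *)
Definition is_slope l x1 y1 x2 y2 : Prop :=
  l * (x2 - x1) = y2 - y1 /\
  l * (y1 + y2) = x1 ^+ 2 + x1 * x2 + x2 ^+ 2 + a2 * (x1 + x2) + a4.

Definition slope_sum l x1 y1 x2 : point F :=
  let x3 := l ^+ 2 - a2 - x1 - x2 in Pt x3 (- (l * (x3 - x1) + y1)).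

Lemma add_pt_slope l x1 y1 x2 y2 :
  is_slope l x1 y1 x2 y2 -> (x1 != x2) || (y1 != - y2) ->
  add_pt (Pt x1 y1) (Pt x2 y2) = slope_sum l x1 y1 x2.
Proof.
case=> chord tangent; rewrite /add_pt -negb_and => /negbTE nopp; rewrite nopp.
have [eq_x|neq_x] := eqVneq x1 x2; last first.
  by rewrite -chord mulfK // subr_eq0 eq_sym.
move: nopp chord tangent; rewrite -eq_x eqxx subrr mulr0 /= => nopp.
move=> /esym/eqP; rewrite subr_eq0 => /eqP eq_y; subst y2; move=> tangent.
have y2_neq0 : 2%:R * y1 != 0 by rewrite mulr_natl mulr2n addr_eq0 nopp.
suff -> : 3%:R * x1 ^+ 2 + 2%:R * a2 * x1 + a4 = l * (2%:R * y1).
  by rewrite mulfK.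
by rewrite (_ : 2%:R * y1 = y1 + y1) ?tangent; ring.
Qed.

Lemma add_pt_opp x y : add_pt (Pt x y) (Pt x (- y)) = Inf.
Proof. by rewrite /add_pt opprK !eqxx. Qed.

Lemma add_pt_double_eq0 x : add_pt (Pt x 0) (Pt x 0) = Inf.
Proof. by rewrite /add_pt oppr0 !eqxx. Qed.

Lemma add_pt0 P : add_pt P Inf = P.
Proof. by case: P. Qed.

Lemma is_slope_ordinates x1 y1 x2 y2 :
  on_curve (Pt x1 y1) -> on_curve (Pt x2 y2) -> y1 + y2 != 0 ->
  is_slope ((x1 ^+ 2 + x1 * x2 + x2 ^+ 2 + a2 * (x1 + x2) + a4) / (y1 + y2))
    x1 y1 x2 y2.
Proof.
move=> /= P_on Q_on sum_y_neq0; split; last by rewrite divfK.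
apply: (mulIf sum_y_neq0); rewrite mulrAC divfK //.
transitivity (y2 ^+ 2 - y1 ^+ 2); last by ring.
by rewrite P_on Q_on; ring.
Qed.

Lemma is_slope_exists x1 y1 x2 y2 :
  on_curve (Pt x1 y1) -> on_curve (Pt x2 y2) -> (x1 != x2) || (y1 != - y2) ->
  exists l, is_slope l x1 y1 x2 y2.
Proof.
move=> P_on Q_on; have [y_opp|] := eqVneq y1 (- y2); last first.
  by rewrite -addr_eq0 => sum_y_neq0 _; eexists; exact: is_slope_ordinates.
rewrite orbF => neq_x; have dx_neq0 : x2 - x1 != 0 by rewrite subr_eq0 eq_sym.
exists ((y2 - y1) / (x2 - x1)); split; first by rewrite divfK.
apply: (mulIf dx_neq0); rewrite mulrAC divfK //.
transitivity (y2 ^+ 2 - y1 ^+ 2); first by ring.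
by move: P_on Q_on => /= -> ->; ring.
Qed.

Lemma add_pt_slope_sum x1 y1 x2 y2 :
  on_curve (Pt x1 y1) -> on_curve (Pt x2 y2) -> (x1 != x2) || (y1 != - y2) ->
  exists2 l, is_slope l x1 y1 x2 y2
    & add_pt (Pt x1 y1) (Pt x2 y2) = slope_sum l x1 y1 x2.
Proof.
move=> P_on Q_on nopp; have [l slope] := is_slope_exists P_on Q_on nopp.
by exists l => //; exact: add_pt_slope slope nopp.
Qed.

Lemma double_pt_slope_sum x y : y + y != 0 -> on_curve (Pt x y) ->
  exists2 l, is_slope l x y x y & add_pt (Pt x y) (Pt x y) = slope_sum l x y x.
Proof.
move=> y_neq0 P_on; apply: add_pt_slope_sum => //.
by rewrite -addr_eq0 y_neq0 orbT.
Qed.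

Lemma on_curve_slope_sum l x1 y1 x2 y2 :
  on_curve (Pt x1 y1) -> is_slope l x1 y1 x2 y2 ->
  on_curve (slope_sum l x1 y1 x2).
Proof.
move=> /= P_on [chord tangent].
have -> : a6 = y1 ^+ 2 - x1 ^+ 3 - a2 * x1 ^+ 2 - a4 * x1 by rewrite P_on; ring.
have -> : a4 = l * (y1 + (y1 + l * (x2 - x1)))
               - (x1 ^+ 2 + x1 * x2 + x2 ^+ 2 + a2 * (x1 + x2)).
  by rewrite chord subrKC tangent; ring.
by ring.
Qed.

Lemma on_curve_add P Q : on_curve P -> on_curve Q -> on_curve (add_pt P Q).
Proof.
case: P Q => [|x1 y1] [|x2 y2] // P_on Q_on.
have [/andP[/eqP <- /eqP ->]|] := boolP ((x1 == x2) && (y1 == - y2)).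
  by rewrite -{2}[y2]opprK add_pt_opp.
rewrite negb_and => /(add_pt_slope_sum P_on Q_on)[l slope ->].
exact: on_curve_slope_sum slope.
Qed.

Lemma on_curve_mul n P : on_curve P -> on_curve (mul_pt n P).
Proof. by move=> P_on; elim: n => //= n; exact: on_curve_add. Qed.

Section LeftAlternative.
Variables (x1 y1 x2 y2 lPP lPQ : F).
Hypothesis y1_neq0 : y1 + y1 != 0.
Hypothesis slopePP : is_slope lPP x1 y1 x1 y1.
Hypothesis slopePQ : is_slope lPQ x1 y1 x2 y2.

Let xPP := lPP ^+ 2 - a2 - x1 - x1.
Let yPP := - (lPP * (xPP - x1) + y1).
Let xPQ := lPQ ^+ 2 - a2 - x1 - x2.
Let yPQ := - (lPQ * (xPQ - x1) + y1).

(* In the coordinates that move [P] to the origin with horizontal tangent, [mu]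
   is [y(Q) / x(Q) ^ 2]. The slopes of [P + (P + Q)] and [2P + Q] turn out to be
   [mu^-1 - lPQ] and [mu^-1 - lPP]. *)
Let mu := (x1 - xPQ) / (y1 + y1).

Let xPQ_mu : xPQ = x1 - mu * (y1 + y1).
Proof. by rewrite divfK // subKr. Qed.

Let lPQ_mu : lPQ = lPP + mu * (x2 - x1).
Proof.
case: slopePP slopePQ => _ tangentP [chord tangent].
apply: (mulIf y1_neq0); rewrite mulrDl tangentP mulrAC divfK // /xPQ.
transitivity (lPQ * (y1 + y2) - lPQ * (lPQ * (x2 - x1))); last first.
  by rewrite tangent; ring.
by rewrite chord; ring.
Qed.

Let y2_mu : y2 = y1 + (lPP + mu * (x2 - x1)) * (x2 - x1).
Proof. by rewrite -lPQ_mu slopePQ.1 subrKC. Qed.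

Let a2_mu : a2 = (lPP + mu * (x2 - x1)) ^+ 2 - x1 - x1 - x2 + mu * (y1 + y1).
Proof.
rewrite -lPQ_mu (_ : mu * _ = x1 - xPQ); last by rewrite xPQ_mu; ring.
by rewrite /xPQ; ring.
Qed.

Let a4_mu :
  a4 = lPP * (y1 + y1) - (x1 ^+ 2 + x1 * x1 + x1 ^+ 2 + a2 * (x1 + x1)).
Proof. by rewrite slopePP.2; ring. Qed.

Lemma slope_add_left : mu != 0 -> is_slope (mu^-1 - lPQ) x1 y1 xPQ yPQ.
Proof.
move=> mu_neq0; rewrite /is_slope /yPQ xPQ_mu lPQ_mu a4_mu a2_mu.
by split; field.
Qed.

Lemma slope_double_left : mu != 0 -> is_slope (mu^-1 - lPP) xPP yPP x2 y2.
Proof.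
move=> mu_neq0; rewrite /is_slope /yPP /xPP y2_mu a4_mu a2_mu.
by split; field.
Qed.

Lemma slope_sum_left : mu != 0 ->
  slope_sum (mu^-1 - lPQ) x1 y1 xPQ = slope_sum (mu^-1 - lPP) xPP yPP x2.
Proof.
move=> mu_neq0; rewrite /slope_sum /yPP /xPP xPQ_mu lPQ_mu a2_mu.
by congr Pt; field.
Qed.

Lemma slope_sum_left_alternative :
  add_pt (Pt x1 y1) (slope_sum lPQ x1 y1 x2)
  = add_pt (slope_sum lPP x1 y1 x1) (Pt x2 y2).
Proof.
have [mu_eq0|mu_neq0] := eqVneq mu 0.
  rewrite /slope_sum -/xPQ -/xPP xPQ_mu mu_eq0 mul0r subr0 subrr mulr0 add0r.
  have -> : xPP = x2 by rewrite /xPP a2_mu mu_eq0; ring.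
  rewrite add_pt_opp y2_mu mu_eq0 mul0r addr0.
  by rewrite -[y1 + _]opprK [y1 + _]addrC add_pt_opp.
rewrite (add_pt_slope (slope_add_left mu_neq0)); last first.
  by rewrite eq_sym xPQ_mu -subr_eq0 addrAC subrr add0r oppr_eq0 mulf_neq0.
rewrite slope_sum_left // -(add_pt_slope (slope_double_left mu_neq0)) //.
rewrite -negb_and; apply/negP => /andP[/eqP eq_x /eqP opp_y].
have : mu * (x2 - x1) ^+ 2 = 0.
  transitivity (yPP + y2); last by rewrite opp_y addNr.
  by rewrite /yPP eq_x y2_mu; ring.
move/eqP; rewrite mulf_eq0 (negbTE mu_neq0) expf_eq0 /= => /eqP dx_eq0.
have : mu * (y1 + y1) = 0.
  transitivity (x2 - xPP - mu * (x2 - x1) * (lPP + lPQ)); last first.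
    by rewrite eq_x dx_eq0; ring.
  by rewrite /xPP a2_mu lPQ_mu; ring.
by move/eqP; rewrite mulf_eq0 (negbTE mu_neq0) (negbTE y1_neq0).
Qed.
End LeftAlternative.

Lemma add_pt_double_opp x y l : y + y != 0 -> is_slope l x y x y ->
  add_pt (slope_sum l x y x) (Pt x (- y)) = Pt x y.
Proof.
move=> y_neq0 slope; have [_ tangent] := slope.
have slope' : is_slope (- l) (l ^+ 2 - a2 - x - x)
    (- (l * (l ^+ 2 - a2 - x - x - x) + y)) x (- y).
  rewrite /is_slope.
  have -> : a4 = l * (y + y) - (x ^+ 2 + x * x + x ^+ 2 + a2 * (x + x)).
    by rewrite tangent; ring.
  by split; ring.
rewrite (add_pt_slope slope').
  by rewrite /slope_sum; congr Pt; ring.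
rewrite opprK -negb_and; apply/negP => /andP[/eqP -> /eqP eq_y].
by move: y_neq0; rewrite -{1}eq_y subrr mulr0 add0r addNr eqxx.
Qed.

Lemma add_pt_left_alternative x y Q : y + y != 0 ->
  on_curve (Pt x y) -> on_curve Q ->
  add_pt (Pt x y) (add_pt (Pt x y) Q) = add_pt (add_pt (Pt x y) (Pt x y)) Q.
Proof.
move=> y_neq0 P_on; case: Q => [|x2 y2] Q_on; first by rewrite !add_pt0.
have [lPP slopePP ->] := double_pt_slope_sum y_neq0 P_on.
have [/andP[/eqP <- /eqP eq_y]|] := boolP ((x == x2) && (y == - y2)).
  rewrite (_ : y2 = - y); last by rewrite eq_y opprK.
  by rewrite add_pt_opp add_pt0 add_pt_double_opp.
rewrite negb_and => /(add_pt_slope_sum P_on Q_on)[lPQ slopePQ ->].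
exact: slope_sum_left_alternative.
Qed.

Lemma mul_pt0 n : mul_pt n Inf = Inf.
Proof. by elim: n => //= n ->. Qed.

Lemma mul_pt_double n x y : y + y != 0 -> on_curve (Pt x y) ->
  mul_pt n (add_pt (Pt x y) (Pt x y)) = mul_pt n.*2 (Pt x y).
Proof.
move=> y_neq0 P_on; elim: n => // n IHn; rewrite doubleS [LHS]/= IHn.
by rewrite -add_pt_left_alternative //; exact: on_curve_mul.
Qed.

Lemma mul_ptD_eq0 m n P : mul_pt n P = Inf -> mul_pt (m + n) P = mul_pt m P.
Proof. by move=> nP_eq0; elim: m => // m IHm; rewrite addSn /= IHm. Qed.

Lemma torsion_double P : torsion_pt P -> torsion_pt (add_pt P P).
Proof.
case=> P_on [n [n_gt0 nP_eq0]]; split; first exact: on_curve_add.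
exists n; split=> //; case: P => [|x y] in P_on nP_eq0 *; first exact: mul_pt0.
have [/eqP|y_neq0] := eqVneq (y + y) 0.
  by rewrite addr_eq0 => /eqP eq_y; rewrite {2}eq_y add_pt_opp mul_pt0.
by rewrite mul_pt_double // -addnn mul_ptD_eq0.
Qed.
End ChordTangent.

(** * Curves with full two-torsion *)

Lemma cubic_factor (R : comNzRingType) (r1 r2 r3 x : R) :
  x ^+ 3 + (r1 + r2 + r3) * x ^+ 2 + (r1 * r2 + r2 * r3 + r3 * r1) * x
  + r1 * r2 * r3 = (x + r1) * (x + r2) * (x + r3).
Proof. by ring. Qed.

Section SplitCubic.
Variable F : fieldType.
Implicit Types r x y : F.

Lemma tangent_root_sqr a2 a4 a6 r1 r2 r3 l x y :
  r1 + r2 + r3 = a2 -> r1 * r2 + r2 * r3 + r3 * r1 = a4 -> r1 * r2 * r3 = a6 ->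
  y + y != 0 -> on_curve a2 a4 a6 (Pt x y) -> is_slope a2 a4 l x y x y ->
  (((x + r1) ^+ 2 - (r2 - r1) * (r3 - r1)) / (y + y)) ^+ 2
  = l ^+ 2 - a2 - x - x + r1.
Proof.
move=> <- <- <-; rewrite /on_curve cubic_factor => y_neq0 P_on [_ tangent].
have yy_neq0 : (y + y) ^+ 2 != 0 by rewrite expf_neq0.
apply: (mulIf yy_neq0); rewrite expr_div_n divfK //.
transitivity ((l * (y + y)) ^+ 2
  + (r1 - (r1 + r2 + r3) - x - x) * 4%:R * y ^+ 2).
  by rewrite tangent P_on; ring.
by ring.
Qed.

Lemma double_root_sqr r1 r2 r3 x y (a2 := r1 + r2 + r3)
    (a4 := r1 * r2 + r2 * r3 + r3 * r1) (a6 := r1 * r2 * r3) :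
  y + y != 0 -> on_curve a2 a4 a6 (Pt x y) ->
  exists X Y u1 u2 u3, [/\ add_pt a2 a4 (Pt x y) (Pt x y) = Pt X Y,
    u1 ^+ 2 = X + r1, u2 ^+ 2 = X + r2 & u3 ^+ 2 = X + r3].
Proof.
move=> y_neq0 P_on; have [l slope P2_eq] := double_pt_slope_sum y_neq0 P_on.
have root_sqr := tangent_root_sqr _ _ _ y_neq0 P_on slope.
eexists _, _, _, _, _; split; first exact: P2_eq.
- exact: root_sqr.
- by apply: (root_sqr r2 r3 r1); rewrite /a2 /a4 /a6; ring.
- by apply: (root_sqr r3 r1 r2); rewrite /a2 /a4 /a6; ring.
Qed.

Section TwoTorsion.
Variables r1 r2 r3 : F.
Hypotheses (neq12 : r1 != r2) (neq13 : r1 != r3) (neq23 : r2 != r3).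

Local Notation a2 := (r1 + r2 + r3).
Local Notation a4 := (r1 * r2 + r2 * r3 + r3 * r1).
Local Notation a6 := (r1 * r2 * r3).

Definition two_torsion (u : 'Z_2 * 'Z_2) : point F :=
  if u.1 == 0 then if u.2 == 0 then Inf else Pt (- r2) 0
  else if u.2 == 0 then Pt (- r1) 0 else Pt (- r3) 0.

Lemma Z2_eq0_or_1 (u : 'Z_2) : u = 0 \/ u = 1.
Proof. by case: u => [[|[|//]] lt_u]; [left|right]; apply: val_inj. Qed.

Lemma two_torsion_inj : injective two_torsion.
Proof.
move=> [u v] [u' v']; rewrite /two_torsion.
have [->|->] := Z2_eq0_or_1 u; have [->|->] := Z2_eq0_or_1 v;
have [->|->] := Z2_eq0_or_1 u'; have [->|->] := Z2_eq0_or_1 v' => //= -[];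
  by move=> /oppr_inj eq_r; move: neq12 neq13 neq23; rewrite eq_r eqxx.
Qed.

Lemma add_pt_two_torsion r r' r'' : r != r' -> r + r' + r'' = a2 ->
  add_pt a2 a4 (Pt (- r) 0) (Pt (- r') 0) = Pt (- r'') 0.
Proof.
move=> neq_r <-; rewrite /add_pt (inj_eq oppr_inj) (negbTE neq_r) /=.
by rewrite !subrr mul0r; congr Pt; ring.
Qed.

Local Arguments add_pt : simpl never.

Lemma two_torsionD u v :
  two_torsion (u + v) = add_pt a2 a4 (two_torsion u) (two_torsion v).
Proof.
case: u v => [u v] [u' v']; rewrite /two_torsion.
have [->|->] := Z2_eq0_or_1 u; have [->|->] := Z2_eq0_or_1 v;
have [->|->] := Z2_eq0_or_1 u'; have [->|->] := Z2_eq0_or_1 v';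
  rewrite /= ?add_pt_double_eq0 //; symmetry;
  apply: add_pt_two_torsion; rewrite // 1?eq_sym //; ring.
Qed.

Lemma torsion_pt_two_torsion u : torsion_pt a2 a4 a6 (two_torsion u).
Proof.
have torsion_root x : (x + r1) * (x + r2) * (x + r3) = 0 ->
    torsion_pt a2 a4 a6 (Pt x 0).
  move=> x_root; split; first by rewrite /on_curve cubic_factor x_root expr0n.
  by exists 2%N; split=> //; rewrite /= add_pt0 add_pt_double_eq0.
case: u => u v; rewrite /two_torsion; case: eqP => _; case: eqP => _.
- by split=> //; exists 1%N.
- by apply: torsion_root; rewrite addNr mulr0 mul0r.
- by apply: torsion_root; rewrite addNr !mul0r.
- by apply: torsion_root; rewrite addNr mulr0.
Qed.

Lemma on_curve_two_torsion x : on_curve a2 a4 a6 (Pt x 0) ->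
  exists u, two_torsion u = Pt x 0.
Proof.
rewrite /on_curve cubic_factor expr0n => /esym/eqP; rewrite !mulf_eq0 -orbA.
case/or3P; rewrite addr_eq0 => /eqP ->.
- by exists (1, 0).
- by exists (0, 1).
- by exists (1, 1).
Qed.
End TwoTorsion.
End SplitCubic.

(** * Integrality of torsion points *)

Section ValuationRing.
Variables (F : fieldType) (O : subringClosed F).
Hypothesis valuation_ring : forall z, (z \in O) || (z^-1 \in O).

Definition max_ideal : {pred F} := [pred z | (z == 0) || (z^-1 \notin O)].

Local Notation M := max_ideal.

Lemma notin_max_ideal z : (z \notin M) = (z != 0) && (z^-1 \in O).
Proof. by rewrite inE negb_or negbK. Qed.

Lemma notin_valuation_ring z : z \notin O -> z^-1 \in M.
Proof. by move=> zNO; rewrite inE invrK zNO orbT. Qed.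

Lemma max_ideal_sub z : z \in M -> z \in O.
Proof.
rewrite inE => /orP[/eqP->|zVNO]; first exact: rpred0.
by have := valuation_ring z; rewrite (negbTE zVNO) orbF.
Qed.

Lemma max_ideal0 : 0 \in M.
Proof. by rewrite inE eqxx. Qed.

Lemma one_notin_max_ideal : 1 \notin M.
Proof. by rewrite notin_max_ideal oner_neq0 invr1 rpred1. Qed.

Lemma max_idealMl a z : a \in O -> z \in M -> a * z \in M.
Proof.
move=> aO zM; have [->|a_neq0] := eqVneq a 0; first by rewrite mul0r max_ideal0.
have [->|z_neq0] := eqVneq z 0; first by rewrite mulr0 max_ideal0.
apply: contraLR zM; rewrite !notin_max_ideal z_neq0 invfM => /andP[_ zVO].
by rewrite -(mulVKf a_neq0 z^-1) rpredM.
Qed.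

Lemma max_idealN z : z \in M -> - z \in M.
Proof. by rewrite -mulN1r; apply: max_idealMl; rewrite rpredN1. Qed.

Lemma max_idealD z w : z \in M -> w \in M -> z + w \in M.
Proof.
wlog ratioO : z w / w / z \in O => [hwlog zM wM|zM wM].
  have /orP[/hwlog|] := valuation_ring (w / z); first exact.
  by rewrite invf_div addrC => /hwlog; exact.
have [->|z_neq0] := eqVneq z 0; first by rewrite add0r.
have -> : z + w = (1 + w / z) * z by field.
by rewrite max_idealMl ?rpredD ?rpred1.
Qed.

Lemma max_ideal_sqr z : z ^+ 2 \in M -> z \in M.
Proof.
apply: contraLR; rewrite !notin_max_ideal expf_eq0 /= -exprVn => /andP[-> zVO].
exact: rpredX.
Qed.

Definition eqmodm z c : Prop := c \in O /\ z - c \in M.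

Lemma eqmodm_in z c : eqmodm z c -> z \in O.
Proof. by case=> cO zcM; rewrite -(subrK c z) rpredD // max_ideal_sub. Qed.

Lemma eqmodm_refl c : c \in O -> eqmodm c c.
Proof. by move=> cO; split; rewrite ?subrr ?max_ideal0. Qed.

Lemma eqmodm0 z : z \in M -> eqmodm z 0.
Proof. by move=> zM; split; rewrite ?subr0 ?rpred0. Qed.

Lemma eqmodmD z c w d : eqmodm z c -> eqmodm w d -> eqmodm (z + w) (c + d).
Proof.
move=> [cO zcM] [dO wdM]; split; first exact: rpredD.
by rewrite opprD addrACA; exact: max_idealD.
Qed.

Lemma eqmodmN z c : eqmodm z c -> eqmodm (- z) (- c).
Proof.
by case=> cO zcM; split; [rewrite rpredN|rewrite -opprD; exact: max_idealN].
Qed.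

Lemma eqmodmM z c w d : eqmodm z c -> eqmodm w d -> eqmodm (z * w) (c * d).
Proof.
move=> zc wd; have zO := eqmodm_in zc; case: zc wd => cO zcM [dO wdM].
split; first exact: rpredM.
rewrite (_ : _ - _ = z * (w - d) + d * (z - c)); last by ring.
by apply: max_idealD; exact: max_idealMl.
Qed.

Lemma eqmodmX n z c : eqmodm z c -> eqmodm (z ^+ n) (c ^+ n).
Proof.
move=> zc; elim: n => [|n IHn]; last by rewrite !exprS; exact: eqmodmM.
by rewrite !expr0; apply: eqmodm_refl; exact: rpred1.
Qed.

Lemma eqmodm_notin z c : eqmodm z c -> c \notin M -> z \notin M.
Proof.
case=> _ zcM; apply: contra => zM.
by rewrite -(subKr z c); apply: max_idealD => //; exact: max_idealN.
Qed.

Lemma eqmodmV z c : eqmodm z c -> c \notin M -> eqmodm z^-1 c^-1.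
Proof.
move=> zc cNM; have := eqmodm_notin zc cNM.
move: (cNM); rewrite !notin_max_ideal => /andP[c_neq0 cVO] /andP[z_neq0 zVO].
split=> //; rewrite (_ : _ - _ = z^-1 * c^-1 * - (z - c)).
  by apply: max_idealMl; [exact: rpredM|exact/max_idealN/zc.2].
by field; rewrite z_neq0 c_neq0.
Qed.

Variables a2 a4 a6 : F.
Hypotheses (a2O : a2 \in O) (a4O : a4 \in O) (a6O : a6 \in O).

Local Notation on_curve := (on_curve a2 a4 a6).
Local Notation add_pt := (add_pt a2 a4).
Local Notation mul_pt := (mul_pt a2 a4).

(* The point [P] reduces to [Inf], with [x ~ (p / t) ^ 2] and [y ~ (p / t) ^ 3]:
   in the formal group, with parameter [x / y], it is [t / p] to first order. *)
Definition formal_pt (t p : F) (P : point F) : Prop :=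
  if P is Pt x y
  then eqmodm (x * t ^+ 2) (p ^+ 2) /\ eqmodm (y * t ^+ 3) (p ^+ 3)
  else False.

Hypothesis residue_pchar0 : forall n, n.+1%:R \notin M.

Section FormalGroup.
Variable t : F.
Hypotheses (tM : t \in M) (t_neq0 : t != 0).

Lemma eqmodm0_coef n a : a \in O -> eqmodm (a * t ^+ n.+1) 0.
Proof.
move=> aO; apply/eqmodm0/max_idealMl => //.
by rewrite exprSr max_idealMl ?rpredX // max_ideal_sub.
Qed.

Lemma formal_slope_sum p q l x1 y1 x2 : p + q != 0 ->
  eqmodm (x1 * t ^+ 2) (p ^+ 2) -> eqmodm (y1 * t ^+ 3) (p ^+ 3) ->
  eqmodm (x2 * t ^+ 2) (q ^+ 2) ->
  eqmodm (l * t) ((p ^+ 2 + p * q + q ^+ 2) / (p + q)) ->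
  formal_pt t (p * q / (p + q)) (slope_sum a2 l x1 y1 x2).
Proof.
move=> pq_neq0 x1t y1t x2t lt.
have a2t : eqmodm (a2 * t ^+ 2) 0 by exact: eqmodm0_coef.
rewrite /slope_sum /=; set x3 := _ - x2.
have x3t : eqmodm (x3 * t ^+ 2) ((p * q / (p + q)) ^+ 2).
  have -> : x3 * t ^+ 2
      = (l * t) ^+ 2 - a2 * t ^+ 2 - x1 * t ^+ 2 - x2 * t ^+ 2.
    by rewrite /x3; ring.
  rewrite (_ : (p * q / (p + q)) ^+ 2 =
    ((p ^+ 2 + p * q + q ^+ 2) / (p + q)) ^+ 2 - 0 - p ^+ 2 - q ^+ 2).
    by do 3![apply: eqmodmD; last exact: eqmodmN]; exact: eqmodmX.
  by field.
split=> //.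
have -> : - (l * (x3 - x1) + y1) * t ^+ 3
    = - ((l * t) * (x3 * t ^+ 2 - x1 * t ^+ 2) + y1 * t ^+ 3) by ring.
rewrite (_ : (p * q / (p + q)) ^+ 3 = - ((p ^+ 2 + p * q + q ^+ 2) / (p + q)
    * ((p * q / (p + q)) ^+ 2 - p ^+ 2) + p ^+ 3)); last by field.
apply/eqmodmN/eqmodmD => //; apply: eqmodmM => //.
by apply: eqmodmD => //; exact: eqmodmN.
Qed.

Lemma formal_add p q P Q : p ^+ 3 + q ^+ 3 \notin M ->
  on_curve P -> on_curve Q -> formal_pt t p P -> formal_pt t q Q ->
  formal_pt t (p * q / (p + q)) (add_pt P Q).
Proof.
case: P Q => [|x1 y1] [|x2 y2] // pqNM P_on Q_on [x1t y1t] [x2t y2t].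
have yt : eqmodm ((y1 + y2) * t ^+ 3) (p ^+ 3 + q ^+ 3).
  by rewrite mulrDl; exact: eqmodmD.
have y_neq0 : y1 + y2 != 0.
  have := eqmodm_notin yt pqNM; rewrite notin_max_ideal mulf_eq0 negb_or.
  by case/andP => /andP[].
have nopp : (x1 != x2) || (y1 != - y2) by rewrite -addr_eq0 y_neq0 orbT.
have slope := is_slope_ordinates P_on Q_on y_neq0.
have pq3_neq0 : p ^+ 3 + q ^+ 3 != 0.
  by move: pqNM; rewrite notin_max_ideal => /andP[].
have pq_neq0 : p + q != 0.
  apply: contraNneq pq3_neq0 => pq_eq0.
  have -> : p ^+ 3 + q ^+ 3 = (p + q) * (p ^+ 2 - p * q + q ^+ 2) by ring.
  by rewrite pq_eq0 mul0r.
rewrite (add_pt_slope slope nopp); apply: formal_slope_sum => //.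
(* The two zeros are the residues of [a2 * t ^+ 2] and [a4 * t ^+ 4]. *)
have -> : (p ^+ 2 + p * q + q ^+ 2) / (p + q) =
    ((p ^+ 2) ^+ 2 + p ^+ 2 * q ^+ 2 + (q ^+ 2) ^+ 2
     + 0 * (p ^+ 2 + q ^+ 2) + 0) / (p ^+ 3 + q ^+ 3).
  by field; rewrite pq3_neq0.
set l := _ / _.
have -> : l * t =
    ((x1 * t ^+ 2) ^+ 2 + x1 * t ^+ 2 * (x2 * t ^+ 2)
    + (x2 * t ^+ 2) ^+ 2 + a2 * t ^+ 2 * (x1 * t ^+ 2 + x2 * t ^+ 2)
    + a4 * t ^+ 4) / ((y1 + y2) * t ^+ 3)
  by rewrite /l; field; rewrite y_neq0 t_neq0.
apply: eqmodmM; last exact: eqmodmV.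
apply: eqmodmD; last exact: eqmodm0_coef.
apply: eqmodmD; last by apply: eqmodmM; [exact: eqmodm0_coef|exact: eqmodmD].
apply: eqmodmD; last exact: eqmodmX.
by apply: eqmodmD; [exact: eqmodmX|exact: eqmodmM].
Qed.

Lemma formal_mul n P : on_curve P -> formal_pt t 1 P ->
  formal_pt t n.+1%:R^-1 (mul_pt n.+1 P).
Proof.
move=> P_on P_formal; elim: n => [|n IHn]; first by rewrite invr1 /= add_pt0.
have n_neq0 m : m.+1%:R != 0 :> F.
  by have := residue_pchar0 m; rewrite notin_max_ideal => /andP[].
have cubes_unit : 1 ^+ 3 + n.+1%:R^-1 ^+ 3 \notin M.
  apply: contra (residue_pchar0 (n.+1 ^ 3)).
  move=> /(max_idealMl (rpred_nat O (n.+1 ^ 3))).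
  by rewrite expr1n exprVn natrX mulrDr mulr1 divff ?expf_neq0 // -natrX natr1.
have -> : n.+2%:R^-1 = 1 * n.+1%:R^-1 / (1 + n.+1%:R^-1) :> F.
  by field; rewrite nat1r natr1 !n_neq0.
exact: formal_add cubes_unit P_on (on_curve_mul n.+1 P_on) P_formal IHn.
Qed.
End FormalGroup.

Lemma torsion_integral x y : torsion_pt a2 a4 a6 (Pt x y) -> x \in O.
Proof.
case=> P_on [[|n] [n_gt0 nP_eq0]] //; apply/negP => /negP xNO.
have xVM := notin_valuation_ring xNO; have xVO := max_ideal_sub xVM.
have x_neq0 : x != 0 by apply: contraNneq xNO => ->; rewrite rpred0.
have y2x3 : eqmodm (y ^+ 2 / x ^+ 3) 1.
  rewrite P_on; split; first exact: rpred1.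
  rewrite (_ : _ - 1 = (a2 + a4 * x^-1 + a6 * x^-1 ^+ 2) * x^-1); last by field.
  by rewrite max_idealMl // !rpredD ?rpredM ?rpredX.
have y_neq0 : y != 0.
  apply: contraTneq one_notin_max_ideal => y_eq0; rewrite negbK.
  case: y2x3 => _; rewrite y_eq0 expr0n mul0r sub0r => /max_idealN.
  by rewrite opprK.
have x3y2 : eqmodm (x ^+ 3 / y ^+ 2) 1.
  by have := eqmodmV y2x3 one_notin_max_ideal; rewrite invf_div invr1.
pose t := x / y.
have tM : t \in M.
  apply: max_ideal_sqr; rewrite (_ : t ^+ 2 = x ^+ 3 / y ^+ 2 * x^-1).
    by rewrite max_idealMl // (eqmodm_in x3y2).
  by rewrite /t; field; rewrite x_neq0.
have t_neq0 : t != 0 by rewrite mulf_neq0 ?invr_eq0.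
have P_formal : formal_pt t 1 (Pt x y).
  have xt : x * t ^+ 2 = x ^+ 3 / y ^+ 2 by rewrite /t; field.
  have yt : y * t ^+ 3 = x ^+ 3 / y ^+ 2 by rewrite /t; field.
  by rewrite /formal_pt !expr1n xt yt.
by have := formal_mul tM t_neq0 n P_on P_formal; rewrite nP_eq0.
Qed.
End ValuationRing.

(** * Polynomials and rational functions *)

Lemma rat_sqr_neq_natr p n (r : rat) : odd (logn p n) -> r ^+ 2 != n%:R.
Proof.
move=> odd_log; apply/eqP => r_sqr.
have n_gt0 : (0 < n)%N by case: n odd_log {r_sqr} => [|//]; rewrite logn0.
have den_gt0 : (0 < `|denq r| ^ 2)%N by rewrite expn_gt0 absz_gt0 denq_neq0.
have : numq r ^+ 2 = n%:R * denq r ^+ 2.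
  apply: (@intr_inj rat); rewrite [LHS]rmorphXn [RHS]rmorphM rmorph_nat -r_sqr.
  rewrite [X in _ = _ * X]rmorphXn -exprMn -[X in X * _]divq_num_den.
  by rewrite divfK ?intr_eq0 ?denq_neq0.
move/(congr1 absz); rewrite abszM !abszX natz absz_nat => /(congr1 (logn p)).
rewrite lognX lognM // lognX => /(congr1 odd).
by rewrite oddD !mul2n !odd_double odd_log.
Qed.

Lemma lead_coef_Poly (R : nzRingType) (s : seq R) :
  last 0 s != 0 -> lead_coef (Poly s) = last 0 s.
Proof. by move=> s_last; rewrite lead_coefE (@PolyK _ 0) // nth_last. Qed.

Lemma deriv_natr (R : nzRingType) n : n%:R^`() = 0 :> {poly R}.
Proof. by rewrite -polyC_natr derivC. Qed.

Section Polynomials.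
Variable K : fieldType.
Implicit Types p q d u v : {poly K}.

Lemma unitr_poly_natr n :
  n%:R != 0 :> K -> (n%:R : {poly K}) \is a GRing.unit.
Proof. by move=> n_neq0; rewrite -polyC_natr rmorph_unit ?unitfE. Qed.

Lemma size1_irreducible_ndvdp p : p != 0 ->
  (forall d, irreducible_poly d -> ~~ (d %| p)) -> size p = 1%N.
Proof.
have [n] := ubnP (size p); elim: n => // n IHn in p *.
rewrite ltnS => le_n p_neq0 ndvd.
apply/eqP/negPn/negP => p_neq1.
suff p_irr : irreducible_poly p by have := ndvd p p_irr; rewrite dvdpp.
split=> [|q q_neq1 q_dvd].
  by rewrite ltn_neqAle eq_sym p_neq1 size_poly_gt0.
apply/negPn/negP => q_neqp; case/eqP: q_neq1; apply: IHn.
- by apply: leq_trans le_n; rewrite ltn_neqAle dvdp_leq // andbT dvdp_size_eqp.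
- by apply: contraNneq p_neq0 => q_eq0; rewrite q_eq0 dvd0p in q_dvd.
- move=> d d_irr; apply: contra (ndvd d d_irr) => d_dvd.
  exact: dvdp_trans q_dvd.
Qed.

Lemma separable_poly_bezout p u v (c : {poly K}) :
  c \is a GRing.unit -> u * p + v * p^`() = c -> separable_poly p.
Proof.
rewrite poly_unitE => /andP[size_c _] bezout; rewrite unlock.
by apply/Bezout_coprimepP; exists (u, v); rewrite /= bezout -size_poly_eq1.
Qed.

Lemma coprimep_separable_subrX2 p q :
  separable_poly (q ^+ 2 - p ^+ 2) -> coprimep p q.
Proof.
move=> separable_sub; rewrite coprimep_def; apply: contraT => /negbTE gcd_neq1.
have := separable_nosquare separable_sub (ltnSn 1) (negbT gcd_neq1).
by rewrite dvdp_sub ?dvdp_exp2r ?dvdp_gcdl ?dvdp_gcdr.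
Qed.
End Polynomials.

Section RationalFunctions.
Variable K : fieldType.
Implicit Types (z w : {fraction {poly K}}) (p q d : {poly K}).

Definition frac_num z : {poly K} :=
  \n_(repr z) %/ gcdp \n_(repr z) \d_(repr z).
Definition frac_den z : {poly K} :=
  \d_(repr z) %/ gcdp \n_(repr z) \d_(repr z).

Lemma coprimep_frac z : coprimep (frac_num z) (frac_den z).
Proof. by rewrite coprimep_div_gcd ?denom_ratioP ?orbT. Qed.

Lemma frac_den_neq0 z : frac_den z != 0.
Proof. by rewrite dvdp_div_eq0 ?dvdp_gcdr ?denom_ratioP. Qed.

Lemma tofrac_repr z : z = (\n_(repr z))%:F / (\d_(repr z))%:F.
Proof.
have d_neq0 := denom_ratioP (repr z).
apply: (canRL (mulfK _)); first by rewrite tofrac_eq0.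
rewrite -{1}[z]reprK; move: (repr z) d_neq0 => r d_neq0.
apply/eqP; rewrite -[_ * _]/(FracField.mul _ _) !piE /FracField.mulf.
by rewrite /equivf /= !numden_Ratio ?mulr1 ?oner_neq0 // mulrC.
Qed.

Lemma frac_num_den z : z = (frac_num z)%:F / (frac_den z)%:F.
Proof.
rewrite {1}[z]tofrac_repr; apply/eqP.
rewrite eqr_div ?tofrac_eq0 ?denom_ratioP ?frac_den_neq0 // -!tofracM tofrac_eq.
by rewrite [eqbRHS]mulrC divp_mulCA ?dvdp_gcdl ?dvdp_gcdr.
Qed.

Lemma frac_den_dvd p q : q != 0 -> frac_den (p%:F / q%:F) %| q.
Proof.
move=> q_neq0; set z := p%:F / q%:F.
have : frac_num z * q = p * frac_den z.
  apply/eqP; rewrite -tofrac_eq !tofracM -eqr_div ?tofrac_eq0 ?frac_den_neq0 //.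
  by rewrite -frac_num_den.
move=> cross; have := coprimep_frac z; rewrite coprimep_sym => /Gauss_dvdpr <-.
by rewrite cross dvdp_mull.
Qed.

(* The localization of the polynomials at those coprime to [d]; for [d]
   irreducible, the valuation ring of the place [d]. *)
Definition adic d : {pred {fraction {poly K}}} :=
  [pred z | coprimep d (frac_den z)].

Lemma adic_frac d p q : q != 0 -> coprimep d q -> p%:F / q%:F \in adic d.
Proof. by move=> q_neq0; apply: coprimep_dvdl; exact: frac_den_dvd. Qed.

Lemma adic_poly d p : p%:F \in adic d.
Proof. by rewrite -[p%:F]divr1 -tofrac1 adic_frac ?oner_neq0 ?coprimep1. Qed.

Lemma adic_subring_closed d : subring_closed (adic d).
Proof.
have den_neq0 z : (frac_den z)%:F != 0 by rewrite tofrac_eq0 frac_den_neq0.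
split=> [|z w z_adic w_adic|z w z_adic w_adic].
- by rewrite -tofrac1 adic_poly.
- rewrite [z]frac_num_den [w]frac_num_den -mulNr addf_div // -tofracN -!tofracM.
  rewrite -tofracD adic_frac ?mulf_neq0 ?frac_den_neq0 //.
  by rewrite coprimepMr; apply/andP.
- rewrite [z]frac_num_den [w]frac_num_den mulf_div -!tofracM.
  by rewrite adic_frac ?mulf_neq0 ?frac_den_neq0 // coprimepMr; apply/andP.
Qed.

HB.instance Definition _ d :=
  GRing.isSubringClosed.Build {fraction {poly K}} (adic d)
    (adic_subring_closed d).

Lemma adic_valuation_ring d : irreducible_poly d ->
  forall z, (z \in adic d) || (z^-1 \in adic d).
Proof.
move=> d_irr z; have [//|/=] := boolP (z \in adic d).
rewrite inE irreducible_poly_coprime // negbK => d_den.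
have num_coprime : coprimep d (frac_num z).
  have := coprimep_frac z; rewrite coprimep_sym; exact: coprimep_dvdr.
rewrite [z]frac_num_den invf_div adic_frac //.
apply: contraTneq num_coprime => ->; rewrite coprimep0 -size_poly_eq1.
by rewrite gtn_eqF //; case: d_irr.
Qed.

Lemma tofrac_natr n : n%:R = (n%:R)%:P%:F :> {fraction {poly K}}.
Proof. by rewrite polyC_natr rmorph_nat. Qed.

Lemma frac_double_eq0 z : 2%:R != 0 :> K -> (z + z == 0) = (z == 0).
Proof.
move=> two_neq0; rewrite -mulr2n -mulr_natl mulf_eq0 tofrac_natr tofrac_eq0.
by rewrite polyC_eq0 (negbTE two_neq0).
Qed.

Lemma adic_residue_pchar0 d : irreducible_poly d ->
  (forall n, n.+1%:R != 0 :> K) -> forall n, n.+1%:R \notin max_ideal (adic d).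
Proof.
move=> d_irr pchar0 n; rewrite tofrac_natr notin_max_ideal tofrac_eq0.
have n_neq0 : (n.+1%:R)%:P != 0 :> {poly K} by rewrite polyC_eq0.
rewrite n_neq0 -[_^-1]mul1r -tofrac1 adic_frac // irreducible_poly_coprime //.
by rewrite gtNdvdp // size_polyC pchar0; case: d_irr.
Qed.

Lemma frac_den_size1 z : size (frac_den z) = 1%N -> exists p, z = p%:F.
Proof.
move/eqP/size_poly1P=> [c c_neq0 den_z]; exists (c^-1 *: frac_num z).
rewrite [LHS]frac_num_den den_z; apply: (canLR (mulfK _)).
  by rewrite tofrac_eq0 polyC_eq0.
by rewrite -tofracM mulrC mul_polyC scalerA divff // scale1r.
Qed.

Lemma adic_all_poly z : (forall d, irreducible_poly d -> z \in adic d) ->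
  exists p, z = p%:F.
Proof.
move=> z_adic; apply/frac_den_size1/size1_irreducible_ndvdp => [|d d_irr].
  exact: frac_den_neq0.
by rewrite -irreducible_poly_coprime //; exact: z_adic.
Qed.

Lemma frac_sqr_poly z p : z ^+ 2 = p%:F -> exists2 q, z = q%:F & q ^+ 2 = p.
Proof.
move=> z_sqr; suff [q z_q] : exists q, z = q%:F.
  by exists q => //; apply/eqP; rewrite -tofrac_eq tofracXn -z_q z_sqr.
have num_sqr : frac_num z ^+ 2 = p * frac_den z ^+ 2.
  apply/eqP; rewrite -tofrac_eq tofracXn [eqbRHS]tofracM tofracXn -z_sqr -exprMn.
  by rewrite {2}[z]frac_num_den divfK ?tofrac_eq0 ?frac_den_neq0.
apply/frac_den_size1/eqP; rewrite -coprimepp.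
have den_dvd : frac_den z %| frac_num z ^+ 2.
  by rewrite num_sqr dvdp_mull // dvdp_exp.
by rewrite (coprimep_dvdl den_dvd) ?coprimep_expr // coprimep_sym coprimep_frac.
Qed.

Lemma frac_sqr_lead_coef z p :
  z ^+ 2 = p%:F -> exists c : K, c ^+ 2 = lead_coef p.
Proof.
by case/frac_sqr_poly => q _ <-; exists (lead_coef q); rewrite lead_coef_exp.
Qed.
End RationalFunctions.

(** * The theorem of Nagell and Lutz over a rational function field *)

Section NagellLutz.
Variable K : fieldType.
Hypothesis pchar0 : forall n, n.+1%:R != 0 :> K.
Implicit Types (x y : {fraction {poly K}}) (p q : {poly K}).

Lemma torsion_poly (a2 a4 a6 : {poly K}) x y :
  torsion_pt a2%:F a4%:F a6%:F (Pt x y) -> exists p q, x = p%:F /\ y = q%:F.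
Proof.
move=> torsionP; have [p x_p] : exists p, x = p%:F.
  apply: adic_all_poly => d d_irr; apply: torsion_integral torsionP.
  - exact: adic_valuation_ring.
  - exact: adic_poly.
  - exact: adic_poly.
  - exact: adic_poly.
  - exact: adic_residue_pchar0.
have [q y_q _] : exists2 q,
    y = q%:F & q ^+ 2 = p ^+ 3 + a2 * p ^+ 2 + a4 * p + a6.
  apply: frac_sqr_poly; case: torsionP => -> _.
  by rewrite x_p !(tofracD, tofracXn, tofracM).
by exists p, q.
Qed.

Lemma nagell_lutz (a2 a4 a6 : {poly K}) x y : y != 0 ->
  torsion_pt a2%:F a4%:F a6%:F (Pt x y) ->
  exists p q, [/\ x = p%:F, y = q%:F &
    q %| 3%:R * p ^+ 2 + 2%:R * a2 * p + a4].
Proof.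
move=> y_neq0 torsionP; have [p [q [x_p y_q]]] := torsion_poly torsionP.
exists p, q; split=> //.
have yy_neq0 : y + y != 0 by rewrite frac_double_eq0.
have [l slope P2_eq] := double_pt_slope_sum yy_neq0 torsionP.1.
have := torsion_double torsionP; rewrite P2_eq.
move=> /torsion_poly[p' [q' [x_p' _]]].
have [m l_m _] : exists2 m, l = m%:F & m ^+ 2 = p' + a2 + p + p.
  apply: frac_sqr_poly; by rewrite !tofracD -x_p' -x_p; ring.
apply/dvdpP; exists (m + m); apply/eqP; rewrite -tofrac_eq; apply/eqP.
have [_] := slope; rewrite l_m x_p y_q -!(tofracD, tofracXn, tofracM) => /eqP.
rewrite tofrac_eq => /eqP tangent; congr (_ %:F).
by transitivity (m * (q + q)); [rewrite tangent|]; ring.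
Qed.

Lemma double_torsion_const (E1 E2 E3 : {poly K})
    (X Y u1 u2 u3 : {fraction {poly K}}) :
  separable_poly (E2 - E1) -> separable_poly (E3 - E1) -> Y != 0 ->
  torsion_pt (E1%:F + E2%:F + E3%:F)
    (E1%:F * E2%:F + E2%:F * E3%:F + E3%:F * E1%:F) (E1%:F * E2%:F * E3%:F)
    (Pt X Y) ->
  u1 ^+ 2 = X + E1%:F -> u2 ^+ 2 = X + E2%:F -> u3 ^+ 2 = X + E3%:F ->
  exists c : K, u1 = c%:P%:F.
Proof.
move=> separable21 separable31 Y_neq0; rewrite -!(tofracM, tofracD) => torsionR.
have [p [q [X_p Y_q q_dvd]]] := nagell_lutz Y_neq0 torsionR.
rewrite X_p -!tofracD => /frac_sqr_poly[v1 -> v1_sqr].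
move=> /frac_sqr_poly[v2 _ v2_sqr] /frac_sqr_poly[v3 _ v3_sqr].
have v_sqr : v1 ^+ 2 * v2 ^+ 2 * v3 ^+ 2 = q ^+ 2.
  have [/= + _] := torsionR.
  rewrite X_p Y_q -!(tofracXn, tofracM, tofracD) => /eqP.
  by rewrite tofrac_eq cubic_factor -v1_sqr -v2_sqr -v3_sqr => /eqP ->.
have v1_dvd_q : v1 %| q.
  have /orP[] : (q == v1 * v2 * v3) || (q == - (v1 * v2 * v3)).
    by rewrite -eqf_sqr -v_sqr !exprMn.
  - by move=> /eqP ->; rewrite -mulrA dvdp_mulr.
  - by move=> /eqP ->; rewrite dvdpNr -mulrA dvdp_mulr.
have v1_dvd : v1 %| (v2 * v3) ^+ 2.
  rewrite (_ : _ ^+ 2 = 3%:R * p ^+ 2 + 2%:R * (E1 + E2 + E3) * p +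
    (E1 * E2 + E2 * E3 + E3 * E1) - v1 * (v1 * (v2 ^+ 2 + v3 ^+ 2))).
    by rewrite dvdp_sub ?dvdp_mulr // (dvdp_trans v1_dvd_q).
  by rewrite exprMn [v1 * _]mulrA -[v1 * v1]expr2 v1_sqr v2_sqr v3_sqr; ring.
have v12 : coprimep v1 v2.
  apply: coprimep_separable_subrX2.
  by rewrite v1_sqr v2_sqr opprD addrACA subrr add0r.
have v13 : coprimep v1 v3.
  apply: coprimep_separable_subrX2.
  by rewrite v1_sqr v3_sqr opprD addrACA subrr add0r.
have : coprimep v1 v1.
  by apply: (coprimep_dvdl v1_dvd); rewrite coprimep_expr // coprimepMr v12 v13.
by rewrite coprimepp => /size_poly1P[c _ ->]; exists c.
Qed.
End NagellLutz.

(** * The curve [E] *)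

Definition poly_a : {poly rat} := 10%:R * 'X ^+ 2 - 8%:R * 'X + 8%:R.
Definition poly_b : {poly rat} := 'X * ('X ^+ 2 - 4%:R * 'X + 20%:R).
Definition poly_c : {poly rat} := ('X + 2%:R) * ('X ^+ 2 - 4%:R).

Definition poly_e1 : {poly rat} := poly_a * poly_b.
Definition poly_e2 : {poly rat} := poly_b * poly_c.
Definition poly_e3 : {poly rat} := poly_a * poly_c.

Lemma e1_poly : e1 = poly_e1%:F.
Proof. by rewrite !(rmorphD, rmorphN, rmorphM, rmorphXn, rmorph_nat). Qed.

Lemma e2_poly : e2 = poly_e2%:F.
Proof. by rewrite !(rmorphD, rmorphN, rmorphM, rmorphXn, rmorph_nat). Qed.

Lemma e3_poly : e3 = poly_e3%:F.
Proof. by rewrite !(rmorphD, rmorphN, rmorphM, rmorphXn, rmorph_nat). Qed.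

Lemma poly_e2Be1 : poly_e2 - poly_e1 =
  Poly [:: 0; - 320%:R; 144%:R; - 192%:R; 56%:R; - 12%:R; 1].
Proof.
rewrite /= !cons_poly_def /poly_e2 /poly_e1 /poly_a /poly_b /poly_c.
by ring.
Qed.

Lemma poly_e3Be1D c : poly_e3 - poly_e1 + c%:P =
  Poly [:: c - 64%:R; - 128%:R; 160%:R; - 288%:R; 60%:R].
Proof.
rewrite /= !cons_poly_def /poly_e3 /poly_e1 /poly_a /poly_b /poly_c.
by ring.
Qed.

Lemma deriv_poly_e2Be1 : (poly_e2 - poly_e1)^`() =
  6%:R * 'X ^+ 5 - 60%:R * 'X ^+ 4 + 224%:R * 'X ^+ 3 - 576%:R * 'X ^+ 2
  + 288%:R * 'X - 320%:R.
Proof.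
rewrite /poly_e2 /poly_e1 /poly_a /poly_b /poly_c.
by rewrite !(deriv_natr, derivXn, derivX, derivN, derivD, derivM) /=; ring.
Qed.

Lemma deriv_poly_e3Be1 : (poly_e3 - poly_e1)^`() =
  240%:R * 'X ^+ 3 - 864%:R * 'X ^+ 2 + 320%:R * 'X - 128%:R.
Proof.
rewrite /poly_e3 /poly_e1 /poly_a /poly_b /poly_c.
by rewrite !(deriv_natr, derivXn, derivX, derivN, derivD, derivM) /=; ring.
Qed.

(* The Bezout coefficients come from the extended Euclidean algorithm. *)
Lemma separable_poly_e2Be1 : separable_poly (poly_e2 - poly_e1).
Proof.
apply: (@separable_poly_bezout _ _
  (- 4140064%:R + 6235488%:R * 'X - 2374032%:R * 'X ^+ 2 + 587160%:R * 'X ^+ 3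
   - 55458%:R * 'X ^+ 4)
  (- 2375680%:R + 2001952%:R * 'X - 2020536%:R * 'X ^+ 2 + 579068%:R * 'X ^+ 3
   - 116346%:R * 'X ^+ 4 + 9243%:R * 'X ^+ 5)
  (2%:R ^+ 20 * 5%:R ^+ 2 * 29%:R)).
  by rewrite !(unitrM, unitrX) ?unitr_poly_natr ?pnatr_eq0.
by rewrite deriv_poly_e2Be1 /poly_e2 /poly_e1 /poly_a /poly_b /poly_c; ring.
Qed.

Lemma separable_poly_e3Be1 : separable_poly (poly_e3 - poly_e1).
Proof.
apply: (@separable_poly_bezout _ _
  (- 3344%:R + 2352%:R * 'X - 420%:R * 'X ^+ 2)
  (- 376%:R + 1228%:R * 'X - 714%:R * 'X ^+ 2 + 105%:R * 'X ^+ 3) (2%:R ^+ 18)).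
  by rewrite unitrX ?unitr_poly_natr ?pnatr_eq0.
by rewrite deriv_poly_e3Be1 /poly_e3 /poly_e1 /poly_a /poly_b /poly_c; ring.
Qed.

Lemma e1_neq_e2 : e1 != e2.
Proof.
rewrite e1_poly e2_poly tofrac_eq eq_sym -subr_eq0.
exact: separable_poly_neq0 separable_poly_e2Be1.
Qed.

Lemma e1_neq_e3 : e1 != e3.
Proof.
rewrite e1_poly e3_poly tofrac_eq eq_sym -subr_eq0.
exact: separable_poly_neq0 separable_poly_e3Be1.
Qed.

Lemma lead_coef_e2Be1 : lead_coef (poly_e2 - poly_e1) = 1.
Proof. by rewrite poly_e2Be1 lead_coef_Poly. Qed.

Lemma lead_coef_e3Be1D c : lead_coef (poly_e3 - poly_e1 + c%:P) = 60%:R.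
Proof. by rewrite poly_e3Be1D lead_coef_Poly. Qed.

Lemma e2_neq_e3 : e2 != e3.
Proof.
rewrite e2_poly e3_poly tofrac_eq; apply/eqP => eq_e23.
have := lead_coef_e3Be1D 0; rewrite addr0 -eq_e23 lead_coef_e2Be1 => /eqP.
by rewrite (eqr_nat rat 1 60).
Qed.

Lemma sqr_neq_e1Be2 z : z ^+ 2 != e1 - e2.
Proof.
rewrite e1_poly e2_poly -tofracB; apply/eqP => /frac_sqr_lead_coef[r r_sqr].
have := sqr_ge0 r; rewrite r_sqr -opprB lead_coefN lead_coef_e2Be1.
by rewrite oppr_ge0 leNgt ltr01.
Qed.

Lemma sqr_neq_e1Be3 z : z ^+ 2 != e1 - e3.
Proof.
rewrite e1_poly e3_poly -tofracB; apply/eqP => /frac_sqr_lead_coef[r r_sqr].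
have := sqr_ge0 r; rewrite r_sqr -opprB lead_coefN -[poly_e3 - _]addr0 -polyC0.
by rewrite lead_coef_e3Be1D oppr_ge0 leNgt ltr0n.
Qed.

Lemma sqr_neq_e3Be1D z (c : rat) : z ^+ 2 != e3 - e1 + c%:P%:F.
Proof.
rewrite e1_poly e3_poly -tofracB -tofracD.
apply/eqP => /frac_sqr_lead_coef[r /eqP]; rewrite lead_coef_e3Be1D.
by apply/negP/(@rat_sqr_neq_natr 3).
Qed.

Lemma torsion_y_eq0 x y : torsion_pt A2 A4 A6 (Pt x y) -> y = 0.
Proof.
have rat_pchar0 n : n.+1%:R != 0 :> rat by rewrite pnatr_eq0.
move=> torsionP; apply/eqP/negPn/negP; rewrite -frac_double_eq0 // => yy_neq0.
have [X [Y [u1 [u2 [u3 [P2_eq u1_sqr u2_sqr u3_sqr]]]]]] :=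
  double_root_sqr yy_neq0 torsionP.1.
have := torsion_double torsionP; rewrite P2_eq => torsionR.
have u1_not_const c : u1 <> c%:P%:F.
  move=> u1_c; have /eqP[] := sqr_neq_e3Be1D u3 (c ^+ 2).
  rewrite polyC_exp tofracXn -u1_c u1_sqr u3_sqr.
  by rewrite [X + e1]addrC addrA subrK addrC.
have [Y_eq0|Y_neq0] := eqVneq Y 0; last first.
  rewrite /A2 /A4 /A6 e1_poly e2_poly e3_poly in torsionR u1_sqr u2_sqr u3_sqr.
  have [c] := double_torsion_const rat_pchar0 separable_poly_e2Be1
    separable_poly_e3Be1 Y_neq0 torsionR u1_sqr u2_sqr u3_sqr.
  exact: u1_not_const.
case: torsionR => /esym/eqP; rewrite Y_eq0 expr0n cubic_factor !mulf_eq0.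
rewrite !addr_eq0 -orbA => /or3P[] /eqP X_eq _.
- case: (u1_not_const 0); apply/eqP.
  by rewrite tofrac0 -sqrf_eq0 u1_sqr X_eq addNr.
- by have := sqr_neq_e1Be2 u1; rewrite u1_sqr X_eq addrC eqxx.
- by have := sqr_neq_e1Be3 u1; rewrite u1_sqr X_eq addrC eqxx.
Qed.

Theorem theorem4p1 :
  torsion_iso A2 A4 A6 ('Z_2 * 'Z_2)%type.
Proof.
exists (two_torsion e1 e2 e3); split.
- exact: two_torsion_inj e1_neq_e2 e1_neq_e3 e2_neq_e3.
- by move=> u; have [] := torsion_pt_two_torsion e1 e2 e3 u.
- exact: two_torsionD e1_neq_e2 e1_neq_e3 e2_neq_e3.
move=> P; split; last by case=> u <-; exact: torsion_pt_two_torsion.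
case: P => [_|x y torsionP]; first by exists 0.
have [P_on _] := torsionP; rewrite (torsion_y_eq0 torsionP) in P_on *.
exact: on_curve_two_torsion P_on.
Qed.
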